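(* Let $N$ be a finitely generated torsion-free nilpotent group. Then $Comm(N)\cong Aut(N_{\mathbb{Q}})$, where $N_{\mathbb{Q}}$ is the rational Mal'cev completion of $N$.
   Context: The abstract commensurator $Comm(G)$ of a group $G$ is the group of equivalence classes of isomorphisms $\alpha:H\cong J$ between subgroups $H,J$ of finite index in $G$, where $\alpha$ and $\alpha'$ are equivalent if they agree on some common subgroup of finite index, and the product of the classes of $\alpha$ and $\beta$ is represented by the partially defined composite $\alpha\circ\beta$. The rational Mal'cev completion $N_{\mathbb{Q}}$ of a finitely generated torsion-free nilpotent group $N$ is the torsion-free, divisible (uniquely divisible) nilpotent group containing $N$ such that every element of $N_{\mathbb{Q}}$ has a positive power in $N$; it is unique up to isomorphism over $N$. $Aut(N_{\mathbb{Q}})$ is its group of automorphisms (as an abstract group). *)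

(* Defs.v *)
From HB Require Import structures.
From mathcomp Require Import all_boot.
From mathcomp Require Import boolp classical_sets functions cardinality.

Set Implicit Arguments.
Unset Strict Implicit.
Unset Printing Implicit Defensive.

Local Open Scope classical_set_scope.
Local Open Scope quotient_scope.
Local Open Scope group_scope.

Section Subgroups.
Variable G : groupType.
Implicit Types (H K : set G) (x y : G).

Definition subgroup H : Prop := group_closed [in H].

Definition left_coset H x : set G := [set x * h | h in H].

Definition finite_index H : Prop := finite_set (range (left_coset H)).

Definition fi_subgroup H : Prop := subgroup H /\ finite_index H.

Definition finitely_generated : Prop :=
  exists2 A : set G, finite_set A & smallest subgroup A = [set: G].

Definition torsion_free : Prop :=
  forall x (n : nat), (0 < n)%N -> x ^+ n = 1 -> x = 1.

Definition divisible : Prop :=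
  forall x (n : nat), (0 < n)%N -> exists y, y ^+ n = x.

(* lower_central 0 is the whole group, i.e. the usual gamma_1.                 *)
Fixpoint lower_central (n : nat) : set G :=
  if n is m.+1 then
    smallest subgroup [set [~ x, y] | x in lower_central m & y in [set: G]]
  else [set: G].

Definition nilpotent : Prop := exists n, lower_central n = [set 1].

Lemma subgroupP H : subgroup H <->
  [/\ H 1, forall x y, H x -> H y -> H (x * y) & forall x, H x -> H x^-1].
Proof.
split=> [gH|[H1 HM HV]].
  have [H1 _] := gH; split.
  - by move: H1; rewrite inE.
  - move=> x y Hx Hy; have := group_closedM gH.
    by move=> /(_ x y); rewrite !inE; apply.
  - move=> x Hx; have := group_closedV gH.
    by move=> /(_ x); rewrite !inE; apply.
split; first by rewrite inE.
by move=> x y; rewrite !inE => Hx Hy; apply: HM => //; apply: HV.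
Qed.

Lemma left_coset_eqP H x y : subgroup H ->
  left_coset H x = left_coset H y <-> H (x^-1 * y).
Proof.
move=> /subgroupP[H1 HM HV]; split=> [e|Hxy].
  have : left_coset H y y by exists 1 => //; rewrite mulg1.
  by rewrite -e => -[h Hh <-]; rewrite mulKg.
rewrite eqEsubset; split=> _ [h Hh <-].
  exists ((x^-1 * y)^-1 * h); first by apply: HM => //; apply: HV.
  by rewrite invgM invgK !mulgA mulgV mul1g.
exists (x^-1 * y * h); first exact: HM.
by rewrite !mulgA mulgV mul1g.
Qed.

Lemma finite_index_sep H (T : Type) (f : G -> T) (A : set T) :
    subgroup H -> finite_set A -> (forall x, A (f x)) ->
    (forall x y, f x = f y -> H (x^-1 * y)) ->
  finite_index H.
Proof.
move=> sH finA fA fH.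
pose g t := left_coset H (xget 1 [set x | f x = t]).
apply: (@sub_finite_set _ _ (g @` A)); last exact: finite_image.
move=> _ [x _ <-]; exists (f x) => //.
apply/(left_coset_eqP _ _ sH); apply: fH.
by case: xgetP => [? _ ->//|/(_ x) /(_ erefl)].
Qed.

Lemma fi_subgroupT : fi_subgroup [set: G].
Proof.
have sT : subgroup [set: G] by apply/subgroupP; split.
split=> //.
exact: (@finite_index_sep _ _ (fun=> tt) [set tt] sT (finite_set1 _)).
Qed.

Lemma fi_subgroupI H K : fi_subgroup H -> fi_subgroup K -> fi_subgroup (H `&` K).
Proof.
move=> [sH fH] [sK fK].
have sHK : subgroup (H `&` K).
  move: (sH) (sK) => /subgroupP[H1 HM HV] /subgroupP[K1 KM KV].
  apply/subgroupP; split=> //.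
  - by move=> x y [? ?] [? ?]; split; [apply: HM|apply: KM].
  - by move=> x [? ?]; split; [apply: HV|apply: KV].
split=> //.
apply: (@finite_index_sep _ _ (fun x => (left_coset H x, left_coset K x)) _ sHK
  (finite_setX fH fK)); first by move=> x; split; exists x.
move=> x y [/(left_coset_eqP _ _ sH) ? /(left_coset_eqP _ _ sK) ?].
by split.
Qed.

End Subgroups.

Section Commensurator.
Variable G : groupType.

(* An isomorphism cdom ~ ccod between finite-index subgroups.  The values of   *)
(* cmap outside cdom are irrelevant: they are never looked at by comm_equiv.   *)
Record commensuration := Commensuration {
  cdom : set G;
  ccod : set G;
  cmap : G -> G;
  cdom_fi : fi_subgroup cdom;
  ccod_fi : fi_subgroup ccod;
  cmapM : forall x y, cdom x -> cdom y -> cmap (x * y) = cmap x * cmap y;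
  cmap_bij : set_bij cdom ccod cmap
}.

HB.instance Definition _ := gen_eqMixin commensuration.
HB.instance Definition _ := gen_choiceMixin commensuration.

Implicit Types a b c : commensuration.

Definition comm_equiv a b : Prop :=
  exists K : set G, [/\ fi_subgroup K, K `<=` cdom a `&` cdom b &
                        {in K, cmap a =1 cmap b}].

Lemma cmap1 a : cmap a 1 = 1.
Proof.
have [/subgroupP[H1 _ _] _] := cdom_fi a.
by apply: (@mulgI _ (cmap a 1)); rewrite -cmapM // !mulg1.
Qed.

Lemma cmapV a x : cdom a x -> cmap a x^-1 = (cmap a x)^-1.
Proof.
have [/subgroupP[_ _ HV] _] := cdom_fi a => Hx.
apply: (@mulgI _ (cmap a x)); rewrite -cmapM ?mulgV ?cmap1 //; exact: HV.
Qed.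

Lemma cmap_cod a x : cdom a x -> ccod a (cmap a x).
Proof. by have [+ _ _] := cmap_bij a => /[apply]. Qed.

Lemma cmap_inj a x y : cdom a x -> cdom a y -> cmap a x = cmap a y -> x = y.
Proof. by have [_ + _] := cmap_bij a => h Hx Hy; apply: h; rewrite inE. Qed.

Lemma cmap_surj a y : ccod a y -> exists2 x, cdom a x & cmap a x = y.
Proof. by have [_ _ +] := cmap_bij a => /[apply]. Qed.

Lemma fi_subgroup_cpreim a (K : set G) :
  fi_subgroup K -> fi_subgroup (cdom a `&` cmap a @^-1` K).
Proof.
move=> [sK fK]; have [sH fH] := cdom_fi a.
move: (sK) (sH) => /subgroupP[K1 KM KV] /subgroupP[H1 HM HV].
have sP : subgroup (cdom a `&` cmap a @^-1` K).
  apply/subgroupP; split.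
  - by split=> //=; rewrite cmap1.
  - move=> x y [Hx Kx] [Hy Ky]; split; first exact: HM.
    by rewrite /= cmapM //; exact: KM.
  - move=> x [Hx Kx]; split; first exact: HV.
    by rewrite /= cmapV //; exact: KV.
split=> //.
pose r x := xget 1 [set y | left_coset (cdom a) y = left_coset (cdom a) x].
have rP x : left_coset (cdom a) (r x) = left_coset (cdom a) x.
  by rewrite /r; case: xgetP => [? _ ->//|/(_ x) /(_ erefl)].
pose f x := (left_coset (cdom a) x, left_coset K (cmap a ((r x)^-1 * x))).
apply: (@finite_index_sep _ _ _ f _ sP (finite_setX fH fK)).
  by move=> x; split; [exists x | exists (cmap a ((r x)^-1 * x))].
move=> x y [exy]; have erxy : r x = r y by rewrite /r exy.
have Hx : cdom a ((r x)^-1 * x) by apply/left_coset_eqP.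
have Hy : cdom a ((r x)^-1 * y) by rewrite erxy; apply/left_coset_eqP.
rewrite -erxy => /(left_coset_eqP _ _ sK); rewrite -cmapV // -cmapM //; last first.
  exact: HV.
rewrite invgM invgK mulgA mulgK => Kxy; split=> //.
by apply/(left_coset_eqP _ _ sH).
Qed.

Section Inverse.
Variable a : commensuration.

Definition cinv_map : G -> G := 'pinv_(fun=> 1) (cdom a) (cmap a).

Lemma cinv_mapP y : ccod a y -> cdom a (cinv_map y) /\ cmap a (cinv_map y) = y.
Proof.
move=> Jy; have [f_ f_inj f_surj] := cmap_bij a.
have [g_fun _ _] := bijpinv_bij (fun=> 1 : G) (cmap_bij a).
split; first exact: g_fun.
by apply: pinvK; rewrite inE; exact: f_surj.
Qed.

Lemma cinv_mapK x : cdom a x -> cinv_map (cmap a x) = x.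
Proof.
by move=> Hx; have [? ?] := cinv_mapP (cmap_cod Hx); exact: cmap_inj Hx _.
Qed.

Lemma cinv_mapM x y :
  ccod a x -> ccod a y -> cinv_map (x * y) = cinv_map x * cinv_map y.
Proof.
move=> /cinv_mapP[Hx ex] /cinv_mapP[Hy ey].
rewrite -{1}ex -{1}ey -cmapM // cinv_mapK //.
by have [/subgroupP[_ HM _] _] := cdom_fi a; exact: HM.
Qed.

Definition comm_inv : commensuration :=
  Commensuration (ccod_fi a) (cdom_fi a) cinv_mapM
    (bijpinv_bij (fun=> 1) (cmap_bij a)).

End Inverse.

Section Composition.
Variables a b : commensuration.

Definition ccomp_dom : set G := cdom b `&` cmap b @^-1` cdom a.
Definition ccomp_map : G -> G := cmap a \o cmap b.
Definition ccomp_cod : set G := ccomp_map @` ccomp_dom.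

Lemma ccomp_dom_fi : fi_subgroup ccomp_dom.
Proof. exact/fi_subgroup_cpreim/cdom_fi. Qed.

Lemma ccomp_cod_fi : fi_subgroup ccomp_cod.
Proof.
rewrite (_ : ccomp_cod = cdom (comm_inv a) `&` cmap (comm_inv a) @^-1` ccod b).
  exact/fi_subgroup_cpreim/ccod_fi.
rewrite eqEsubset; split=> [_ [x [Hx Hy] <-]|y [/= Jy Jy']].
  split; first exact: cmap_cod.
  by rewrite /= cinv_mapK //; exact: cmap_cod.
have [Hy e] := cinv_mapP Jy; have [x Hx e'] := cmap_surj Jy'.
by exists x; [split; rewrite //= e'|rewrite /ccomp_map /= e'].
Qed.

Lemma ccomp_mapM x y :
  ccomp_dom x -> ccomp_dom y -> ccomp_map (x * y) = ccomp_map x * ccomp_map y.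
Proof. by move=> [? ?] [? ?]; rewrite /ccomp_map /= !cmapM. Qed.

Lemma ccomp_map_bij : set_bij ccomp_dom ccomp_cod ccomp_map.
Proof.
apply: inj_bij => x y; rewrite !inE => -[? ?] [? ?] e.
by apply: (@cmap_inj b) => //; exact: (@cmap_inj a).
Qed.

Definition comm_comp : commensuration :=
  Commensuration ccomp_dom_fi ccomp_cod_fi ccomp_mapM ccomp_map_bij.

End Composition.

Lemma id_set_bij : set_bij [set: G] [set: G] id.
Proof. by rewrite setTT_bijective; exists id. Qed.

Definition comm_id : commensuration :=
  Commensuration (fi_subgroupT G) (fi_subgroupT G)
    (fun _ _ _ _ => erefl) id_set_bij.

Lemma comm_equiv_refl a : comm_equiv a a.
Proof. by exists (cdom a); split=> //; exact: cdom_fi. Qed.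

Lemma comm_equiv_sym a b : comm_equiv a b -> comm_equiv b a.
Proof.
by move=> [K [fK sK e]]; exists K; split=> // [x /sK[]//|x /e].
Qed.

Lemma comm_equiv_trans b a c :
  comm_equiv a b -> comm_equiv b c -> comm_equiv a c.
Proof.
move=> [K [fK sK e]] [K' [fK' sK' e']]; exists (K `&` K'); split.
- exact: fi_subgroupI.
- by move=> x [/sK[? ?] /sK'[? ?]].
- by move=> x; rewrite inE => -[Kx Kx']; rewrite e ?e' ?inE.
Qed.

Definition comm_eqv : rel commensuration := fun a b => `[< comm_equiv a b >].

Lemma comm_eqv_refl : reflexive comm_eqv.
Proof. by move=> a; apply/asboolP/comm_equiv_refl. Qed.

Lemma comm_eqv_sym : symmetric comm_eqv.
Proof. by move=> a b; apply/asboolP/asboolP => /comm_equiv_sym. Qed.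

Lemma comm_eqv_trans : transitive comm_eqv.
Proof.
by move=> b a c /asboolP h /asboolP h'; apply/asboolP; exact: comm_equiv_trans h'.
Qed.

Canonical comm_eqv_equiv :=
  EquivRel comm_eqv comm_eqv_refl comm_eqv_sym comm_eqv_trans.

Definition Comm : Type := {eq_quot comm_eqv}.

HB.instance Definition _ := Choice.on Comm.
HB.instance Definition _ := EqQuotient.on Comm.

Lemma CommP a b : \pi_Comm a = \pi_Comm b <-> comm_equiv a b.
Proof. by split=> [/eqmodP/asboolP //|h]; apply/eqmodP/asboolP. Qed.

Lemma comm_comp_equiv a a' b b' : comm_equiv a a' -> comm_equiv b b' ->
  comm_equiv (comm_comp a b) (comm_comp a' b').
Proof.
move=> [K [fK sK e]] [L [fL sL e']].
exists (L `&` (cdom b `&` cmap b @^-1` K)); split.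
- exact/fi_subgroupI/fi_subgroup_cpreim.
- move=> x [Lx [Hx Kx]]; have [_ Hx'] := sL _ Lx; have [? ?] := sK _ Kx.
  by split; split=> //=; rewrite -e' ?inE.
- move=> x; rewrite inE => -[Lx [Hx Kx]]; rewrite /= /ccomp_map /=.
  by rewrite -e' ?inE // e ?inE.
Qed.

Lemma comm_inv_equiv a a' :
  comm_equiv a a' -> comm_equiv (comm_inv a) (comm_inv a').
Proof.
move=> [K [fK sK e]].
exists (cdom (comm_inv a) `&` cmap (comm_inv a) @^-1` K).
have main x : ccod a x -> K (cinv_map a x) ->
    ccod a' x /\ cinv_map a x = cinv_map a' x.
  move=> Jx Kx; have [_ ex] := cinv_mapP Jx; have [_ Hx] := sK _ Kx.
  have ex' : cmap a' (cinv_map a x) = x by rewrite -e ?inE.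
  by split; [rewrite -ex'; exact: cmap_cod|rewrite -{2}ex' cinv_mapK].
split; first exact: fi_subgroup_cpreim.
  by move=> x [Jx Kx]; have [] := main x Jx Kx.
by move=> x; rewrite inE => -[Jx Kx]; have [] := main x Jx Kx.
Qed.

Definition Comm_mul (u v : Comm) : Comm := \pi_Comm (comm_comp (repr u) (repr v)).
Definition Comm_one : Comm := \pi_Comm comm_id.
Definition Comm_inv (u : Comm) : Comm := \pi_Comm (comm_inv (repr u)).

Lemma comm_reprP a : comm_equiv (repr (\pi_Comm a)) a.
Proof. by apply/CommP; rewrite reprK. Qed.

Lemma Comm_mulE a b : Comm_mul (\pi_Comm a) (\pi_Comm b) = \pi_Comm (comm_comp a b).
Proof. by apply/CommP/comm_comp_equiv; exact: comm_reprP. Qed.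

Lemma Comm_invE a : Comm_inv (\pi_Comm a) = \pi_Comm (comm_inv a).
Proof. by apply/CommP/comm_inv_equiv; exact: comm_reprP. Qed.

Lemma Comm_mulA : associative Comm_mul.
Proof.
move=> u v w; rewrite -[u]reprK -[v]reprK -[w]reprK.
set a := repr u; set b := repr v; set c := repr w.
rewrite (Comm_mulE b c) (Comm_mulE a b) (Comm_mulE a) (Comm_mulE _ c).
apply/CommP; exists (cdom (comm_comp a (comm_comp b c))); split=> //.
  exact: cdom_fi.
move=> x Hx; split=> //.
by case: Hx => -[Hx Hx'] Hx''; exact: (conj Hx (conj Hx' Hx'')).
Qed.

Lemma Comm_mul1 : left_id Comm_one Comm_mul.
Proof.
move=> u; rewrite -[u]reprK Comm_mulE; apply/CommP.
by exists (cdom (repr u)); split=> //; exact: cdom_fi.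
Qed.

Lemma Comm_mulr1 : right_id Comm_one Comm_mul.
Proof.
move=> u; rewrite -[u]reprK Comm_mulE; apply/CommP.
by exists (cdom (repr u)); split=> //; exact: cdom_fi.
Qed.

Lemma Comm_mulV : left_inverse Comm_one Comm_inv Comm_mul.
Proof.
move=> u; rewrite -[u]reprK Comm_invE Comm_mulE; set a := repr u.
apply/CommP; exists (cdom a); split; first exact: cdom_fi.
  by move=> x Hx; split=> //; split=> //=; exact: cmap_cod.
by move=> x; rewrite inE => Hx; rewrite /= /ccomp_map /= cinv_mapK.
Qed.

Lemma Comm_mulrV : right_inverse Comm_one Comm_inv Comm_mul.
Proof.
move=> u; rewrite -[u]reprK Comm_invE Comm_mulE; set a := repr u.
apply/CommP; exists (ccod a); split; first exact: ccod_fi.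
  by move=> x Jx; have [? ?] := cinv_mapP Jx; split=> //; split.
by move=> x; rewrite inE => /cinv_mapP[].
Qed.

HB.instance Definition _ := isGroup.Build Comm
  Comm_mulA Comm_mul1 Comm_mulr1 Comm_mulV Comm_mulrV.

End Commensurator.

Section Automorphisms.
Variable G : groupType.

Record aut := MkAut {
  aut_fun :> {multiplicative G -> G};
  aut_bij : bijective aut_fun
}.

HB.instance Definition _ := gen_eqMixin aut.
HB.instance Definition _ := gen_choiceMixin aut.

Implicit Types f g : aut.

Lemma aut_eqP f g : f =1 g -> f = g.
Proof.
case: f g => [[f [[fM]]] fb] [[g [[gM]]] gb] /= /funext e.
by subst g; rewrite (Prop_irrelevance gM fM) (Prop_irrelevance gb fb).
Qed.

Definition aut_mul f g : aut :=
  @MkAut (f \o g : {multiplicative G -> G}) (bij_comp (aut_bij f) (aut_bij g)).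

Definition aut_one : aut :=
  @MkAut (idfun : {multiplicative G -> G}) (inv_bij (fun=> erefl)).

Definition aut_inv_fun f : G -> G := 'pinv_(fun=> 1) [set: G] f.

Lemma aut_inv_funK f : cancel f (aut_inv_fun f).
Proof.
by move=> x; apply: pinvKV; rewrite ?inE // => ? ? _ _ /(bij_inj (aut_bij f)).
Qed.

Lemma aut_inv_funKV f : cancel (aut_inv_fun f) f.
Proof. by move=> y; have [g _ gK] := aut_bij f; rewrite -(gK y) aut_inv_funK. Qed.

Lemma aut_inv_funM f : {morph aut_inv_fun f : x y / x * y}.
Proof. exact: can2_gmulfM (aut_inv_funK f) (aut_inv_funKV f). Qed.

HB.instance Definition _ f :=
  isMultiplicative.Build G G (aut_inv_fun f) (aut_inv_funM f).

Definition aut_inv f : aut :=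
  @MkAut (aut_inv_fun f : {multiplicative G -> G})
    (Bijective (aut_inv_funKV f) (aut_inv_funK f)).

Lemma aut_mulA : associative aut_mul.
Proof. by move=> f g h; apply: aut_eqP. Qed.

Lemma aut_mul1 : left_id aut_one aut_mul.
Proof. by move=> f; apply: aut_eqP. Qed.

Lemma aut_mulr1 : right_id aut_one aut_mul.
Proof. by move=> f; apply: aut_eqP. Qed.

Lemma aut_mulV : left_inverse aut_one aut_inv aut_mul.
Proof. by move=> f; apply: aut_eqP => x; exact: aut_inv_funK. Qed.

Lemma aut_mulrV : right_inverse aut_one aut_inv aut_mul.
Proof. by move=> f; apply: aut_eqP => x; exact: aut_inv_funKV. Qed.

HB.instance Definition _ := isGroup.Build aut
  aut_mulA aut_mul1 aut_mulr1 aut_mulV aut_mulrV.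

End Automorphisms.

(* N_Q is given up to isomorphism over N by an embedding i : N -> Q; between   *)
(* groups, a map preserving products also preserves 1 and inverses.            *)
Definition malcev_completion (N Q : groupType) (i : {multiplicative N -> Q}) :
    Prop :=
  [/\ injective i, torsion_free Q, divisible Q, nilpotent Q &
      forall q : Q, exists2 n : nat, (0 < n)%N & range i (q ^+ n)].

Definition group_isomorphic (G H : groupType) : Prop :=
  exists f : {multiplicative G -> H}, bijective f.

(* Main.v *)
(** In a torsion-free nilpotent group roots are unique, and in any nilpotent group the elements
    having a positive power in a given subgroup form a subgroup (its isolator).  A commensuration
    [a] of N therefore has at most one extension to the completion Q, and it has one: the relation
    "q ^+ m = h and r ^+ m = a h for some m > 0 and h in N" is the isolator in Q * Q of the graph
    of [a], hence the graph of an automorphism of Q.  Conversely an automorphism f of Q restricts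
    to the elements of N sent into N; each element of N has a power in this subgroup, which makes
    its index finite because N is finitely generated nilpotent.  Both the isolator property and
    this finiteness follow from: in a nilpotent group generated by finitely many elements, a
    subgroup containing a positive power of each generator has finite index. *)

Require Import Defs.
From HB Require Import structures.
From mathcomp Require Import all_boot.
From mathcomp Require Import boolp classical_sets functions cardinality.

Set Implicit Arguments.
Unset Strict Implicit.
Unset Printing Implicit Defensive.

Local Open Scope classical_set_scope.
Local Open Scope quotient_scope.
Local Open Scope group_scope.

(** * Subgroups, powers and finite index *)

Section SubgroupBasics.
Variable G : groupType.
Implicit Types (H K : set G) (x y g h u : G).

Lemma subgroup1 H : subgroup H -> H 1.
Proof. by move=> /subgroupP[]. Qed.

Lemma subgroupM H x y : subgroup H -> H x -> H y -> H (x * y).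
Proof. by move=> /subgroupP[_ + _]; apply. Qed.

Lemma subgroupV H x : subgroup H -> H x -> H x^-1.
Proof. by move=> /subgroupP[_ _]; apply. Qed.

Lemma subgroupX H x n : subgroup H -> H x -> H (x ^+ n).
Proof.
move=> sH Hx; elim: n => [|n IHn]; first by rewrite expg0; exact: subgroup1.
by rewrite expgS; exact: subgroupM.
Qed.

Lemma subgroupMl H x y : subgroup H -> H x -> H (x * y) -> H y.
Proof.
by move=> sH Hx Hxy; rewrite -(mulKg x y); apply: subgroupM => //; exact: subgroupV.
Qed.

Lemma subgroupMr H x y : subgroup H -> H y -> H (x * y) -> H x.
Proof.
by move=> sH Hy Hxy; rewrite -(mulgK y x); apply: subgroupM => //; exact: subgroupV.
Qed.

Lemma smallest_subgroup (A : set G) : subgroup (smallest (@subgroup G) A).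
Proof.
apply/subgroupP; split.
- by move=> M [/subgroup1].
- move=> x y Hx Hy M MA; have [sM _] := MA.
  by apply: subgroupM => //; [exact: Hx|exact: Hy].
- move=> x Hx M MA; have [sM _] := MA.
  by apply: subgroupV => //; exact: Hx.
Qed.

(** Pigeonhole: the cosets of the powers of [x] cannot all be distinct, and two equal ones, for
    exponents [m < n], put [x ^+ (n - m)] in [H]. *)
Lemma finite_index_power H x : fi_subgroup H -> exists2 n, (0 < n)%N & H (x ^+ n).
Proof.
move=> [sH fH].
have [m [n [lt_mn e]]] : exists m n, (m < n)%N /\
    left_coset H (x ^+ m) = left_coset H (x ^+ n).
  apply: contrapT => noncoset.
  have inj : {in [set: nat] &, injective (fun k => left_coset H (x ^+ k))}.
    move=> m n _ _ e; have [lt_mn|lt_nm|//] := ltngtP m n; exfalso; apply: noncoset.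
      by exists m, n.
    by exists n, m.
  apply: infinite_nat; rewrite -(eq_finite_set (inj_card_eq inj)).
  by apply: sub_finite_set fH => _ [k _ <-]; exists (x ^+ k).
exists (n - m)%N; first by rewrite subn_gt0.
move/(left_coset_eqP _ _ sH): e; rewrite -(subnKC (ltnW lt_mn)) expgnDr mulKg.
by rewrite subnKC // ltnW.
Qed.

Lemma finite_cosets_index H (F : seq G) : subgroup H ->
  (forall g, exists2 f, f \in F & H (f^-1 * g)) -> fi_subgroup H.
Proof.
move=> sH covF; split=> //.
apply: (@sub_finite_set _ _ (left_coset H @` [set` F])).
  move=> _ [g _ <-]; have [f Ff Hfg] := covF g; exists f => //.
  exact/left_coset_eqP.
exact/finite_image/finite_seq.
Qed.

End SubgroupBasics.

(** * The lower central series and uniqueness of roots *)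

Section LowerCentral.
Variable G : groupType.
Implicit Types (H K : set G) (x y g h u : G).

Lemma lower_central_subgroup k : subgroup (@lower_central G k).
Proof. by case: k => [|k] /=; [case: (fi_subgroupT G)|exact: smallest_subgroup]. Qed.
Hint Resolve lower_central_subgroup : core.

Lemma lower_central1 k : @lower_central G k 1.
Proof. exact: (subgroup1 (lower_central_subgroup k)). Qed.

Lemma lower_centralM k u v :
  @lower_central G k u -> @lower_central G k v -> @lower_central G k (u * v).
Proof. exact: (subgroupM (lower_central_subgroup k)). Qed.

Lemma lower_centralV k u : @lower_central G k u -> @lower_central G k u^-1.
Proof. exact: (subgroupV (lower_central_subgroup k)). Qed.

Lemma lower_centralX k u n : @lower_central G k u -> @lower_central G k (u ^+ n).
Proof. exact: (subgroupX _ (lower_central_subgroup k)). Qed.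

Lemma lower_central_comm k u g :
  @lower_central G k u -> @lower_central G k.+1 [~ u, g].
Proof. by move=> gu; apply: sub_gen_smallest; exists u => //; exists g. Qed.

Lemma lower_centralS k : @lower_central G k.+1 `<=` @lower_central G k.
Proof.
elim: k => [|k IHk]; first by move=> x _.
apply: smallest_sub => [|_ [u gu [g _ <-]]]; first exact: (lower_central_subgroup k.+1).
by apply: lower_central_comm; exact: IHk.
Qed.

Lemma lower_central_conj k u g : @lower_central G k u -> @lower_central G k (u ^ g).
Proof.
move=> gu; rewrite -(mulVKg u (u ^ g)) -commgEl; apply: subgroupM => //.
by apply: lower_centralS; exact: lower_central_comm.
Qed.

(* With [v = [~ x, w]], the element [x ^+ n = (x * v) ^+ n] commutes with [v], which lies
   one step deeper in the series; so [x] commutes with [v] and [v ^+ n = 1]. *)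
Lemma commute_root (n : nat) x w : torsion_free G -> nilpotent G -> (0 < n)%N ->
  commute (x ^+ n) w -> commute x w.
Proof.
move=> tfG [c gc1] n0.
have main k : (k <= c)%N -> forall w, @lower_central G (c - k) w ->
    commute (x ^+ n) w -> commute x w.
  elim: k => [_ v|k IHk ltkc v gv cxv].
    by rewrite subn0 gc1 => -> _; exact: commute1.
  have xvn : (x ^ v) ^+ n = x ^+ n.
    by rewrite -conjXg; apply/conjg_fixP/commgP.
  have cxnt : commute (x ^+ n) [~ x, v].
    rewrite commgEl; apply: commuteM.
      by apply/commuteV/commute_sym/commuteX.
    by rewrite -xvn; apply/commute_sym/commuteX.
  have cxt : commute x [~ x, v].
    apply: IHk; [exact: ltnW| |exact: cxnt].
    rewrite -(invgK [~ x, v]); apply: subgroupV => //.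
    rewrite invgR.
    by rewrite -subnSK //; exact: lower_central_comm.
  have tn1 : [~ x, v] ^+ n = 1.
    apply: (@mulgI _ (x ^+ n)); rewrite -expgMn // commgEl mulVKg xvn mulg1 //.
  by apply/commgP/eqP; exact: tfG n0 tn1.
by move=> cxw; apply: (main c) => //; rewrite subnn.
Qed.

(** As [y] commutes with [x ^+ n = y ^+ n], [x] commutes with [y]; then [x^-1 * y] is a torsion
    element. *)
Lemma unique_root (n : nat) x y : torsion_free G -> nilpotent G -> (0 < n)%N ->
  x ^+ n = y ^+ n -> x = y.
Proof.
move=> tfG nilG n0 exy.
have cxy : commute x y.
  by apply: (commute_root tfG nilG n0); rewrite exy; apply/commute_sym/commuteX.
have /(tfG _ _ n0) : (x^-1 * y) ^+ n = 1.
  rewrite expgMn; last exact/commute_sym/commuteV/commute_sym.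
  by rewrite expVgn exy mulVg.
by move=> /mulg1_eq; rewrite invgK.
Qed.

End LowerCentral.
#[local] Hint Resolve lower_central_subgroup : core.

(** * Finite index of subgroups containing powers of generators *)

Section PowersFiniteIndex.
Variable G : groupType.
Implicit Types (E H : set G) (x y g h u w : G).
Local Notation gamma := (@lower_central G).

Lemma commgMl x y g : [~ x * y, g] = [~ x, g] ^ y * [~ y, g].
Proof. by rewrite /commg /conjg !invgM !mulgA !mulgK. Qed.

Lemma commgMr x y g : [~ g, x * y] = [~ g, y] * [~ g, x] ^ y.
Proof. by rewrite /commg /conjg !invgM !mulgA !mulgK. Qed.

Section Modulo.
Variables (k : nat) (E : set G).
Hypotheses (sE : subgroup E) (gE : gamma k.+1 `<=` E).

(** Conjugation changes [w] by [[~ w, g]], which lies in [gamma k.+1] and so in [E]; this stands in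
    for normality of [E]. *)
Lemma conjg_mod w g : gamma k w -> E w -> E (w ^ g).
Proof.
move=> gw Ew; rewrite -(mulVKg w (w ^ g)) -commgEl; apply: subgroupM => //.
by apply: gE; exact: lower_central_comm.
Qed.

Lemma conjg_by_mod w g : gamma k g -> E w -> E (w ^ g).
Proof.
move=> gg Ew; rewrite -(mulVKg w (w ^ g)) -commgEl -invgR.
by apply: subgroupM => //; apply: subgroupV => //; by apply: gE; exact: lower_central_comm.
Qed.

End Modulo.

(** [[~ u, g]] lies in [gamma k.+1], hence is central modulo [gamma k.+2]; [t] collects the
    errors. *)
Lemma commgX_mod k u g n : gamma k u ->
  exists2 t, gamma k.+2 t & [~ u, g ^+ n] = [~ u, g] ^+ n * t.
Proof.
move=> gu; elim: n => [|n [t gt e]].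
  by exists 1; [exact: lower_central1|rewrite !expg0 commg1 mulg1].
exists ([~ [~ u, g ^+ n], g] ^ t^-1 * t).
  apply: lower_centralM => //; apply: lower_central_conj.
  by apply: lower_central_comm; exact: lower_central_comm.
rewrite expgSr commgMr expgS -[_ ^ g](mulVKg [~ u, g ^+ n]) -commgEl {1}e.
by rewrite /conjg invgK !mulgA mulgVK.
Qed.

Lemma commXg_mod k u g n : gamma k u ->
  exists2 t, gamma k.+2 t & [~ u ^+ n, g] = [~ u, g] ^+ n * t.
Proof.
move=> gu; elim: n => [|n [t gt e]].
  by exists 1; [exact: lower_central1|rewrite !expg0 comm1g mulg1].
have gun : gamma k (u ^+ n) by exact: lower_centralX.
pose r := [~ [~ u, g], u ^+ n].
exists (r ^ ([~ u, g] ^+ n) * t).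
  apply: lower_centralM => //; apply: lower_central_conj.
  by apply: lower_central_comm; exact: lower_central_comm.
rewrite expgS commgMl e -[_ ^ (u ^+ n)](mulVKg [~ u, g]) -commgEl -/r expgS.
by rewrite /conjg !mulgA mulgK.
Qed.

Lemma expgM_mod k c t n : gamma k t ->
  exists2 t', gamma k t' & (c * t) ^+ n = c ^+ n * t'.
Proof.
move=> gt; elim: n => [|n [t' gt' e]].
  by exists 1; [exact: lower_central1|rewrite !expg0 mulg1].
exists (t ^ (c ^+ n) * t'); first by apply: lower_centralM => //; exact: lower_central_conj.
by rewrite expgS e expgS /conjg !mulgA mulgK.
Qed.

Definition mul_lower H k : set G := [set h * u | h in H & u in gamma k].

Lemma mul_lower_subgroup H k : subgroup H -> subgroup (mul_lower H k).
Proof.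
move=> sH; apply/subgroupP; split.
- by exists 1; [apply: subgroup1|exists 1; [exact: lower_central1|rewrite mulg1]].
- move=> _ _ [h Hh [u gu <-]] [h' Hh' [u' gu' <-]].
  exists (h * h'); first exact: subgroupM.
  exists (u ^ h' * u'); first by apply: lower_centralM => //; exact: lower_central_conj.
  by rewrite /conjg !mulgA mulgK.
- move=> _ [h Hh [u gu <-]]; exists h^-1; first exact: subgroupV.
  exists (u^-1 ^ h^-1); first by apply: lower_central_conj; exact: lower_centralV.
  by rewrite /conjg invgM !mulgA invgK mulVg mul1g.
Qed.

Lemma sub_mul_lowerl H k : H `<=` mul_lower H k.
Proof. by move=> h Hh; exists h => //; exists 1; [exact: lower_central1|rewrite mulg1]. Qed.

Lemma sub_mul_lowerr H k : subgroup H -> gamma k `<=` mul_lower H k.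
Proof.
by move=> sH u gu; exists 1; [apply: subgroup1|exists u => //; rewrite mul1g].
Qed.

(** Modulo [gamma k.+2] the commutator is bilinear on [gamma k] and [G]. Membership of [[~ u, x]] in
    [E] thus spreads from [u] in [s] to all of [gamma k], then from [x] in [X] to all of [G]. *)
Lemma lower_central_gen (X s : seq G) k :
    smallest (@subgroup G) [set` X] = [set: G] ->
    (forall a, a \in s -> gamma k a) ->
    gamma k `<=` smallest (@subgroup G) ([set` s] `|` gamma k.+1) ->
  gamma k.+1 `<=` smallest (@subgroup G)
    ([set` [seq [~ a, x] | a <- s, x <- X]] `|` gamma k.+2).
Proof.
move=> genX gs gens.
set E := smallest _ ([set` [seq _ | a <- s, x <- X]] `|` _).
have sE : subgroup E by exact: smallest_subgroup.
have gE : gamma k.+2 `<=` E by move=> g ?; apply: sub_gen_smallest; right.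
have sXE a x : a \in s -> x \in X -> E [~ a, x].
  by move=> sa Xx; apply: sub_gen_smallest; left; apply/allpairsP; exists (a, x).
clearbody E.
have EX u x : gamma k u -> x \in X -> E [~ u, x].
  move=> gu Xx; suff [] : (gamma k `&` [set u | E [~ u, x]]) u by [].
  apply: (smallest_sub _ _ (gens u gu)).
    apply/subgroupP; split.
    - by split; [exact: lower_central1|rewrite /= comm1g; exact: subgroup1].
    - move=> v w [gv Ev] [gw Ew]; split; first exact: lower_centralM.
      rewrite /= commgMl; apply: subgroupM => //; apply: (conjg_mod sE gE) => //.
      exact: lower_central_comm.
    - move=> v [gv Ev]; split; first exact: lower_centralV.
      have : E ([~ v, x] ^ v^-1 * [~ v^-1, x]).
        by rewrite -commgMl mulgV comm1g; exact: subgroup1.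
      apply: subgroupMl => //; apply: (conjg_mod sE gE) => //.
      exact: lower_central_comm.
  move=> v [sv|gv]; split; first exact: gs.
  - exact: sXE.
  - exact: lower_centralS.
  - by apply: gE; exact: lower_central_comm.
apply: smallest_sub => // _ [u gu [g _ <-]].
suff : [set g | E [~ u, g]] g by [].
have : [set: G] g by []; rewrite -genX; apply: smallest_sub => [|x Xx]; last exact: EX.
apply/subgroupP; split.
- by rewrite /= commg1; exact: subgroup1.
- move=> v w Ev Ew; rewrite /= commgMr; apply: subgroupM => //.
  by apply: (conjg_mod sE gE) => //; exact: lower_central_comm.
- move=> v Ev; have : E ([~ u, v^-1] * [~ u, v] ^ v^-1).
    by rewrite -commgMr mulgV commg1; exact: subgroup1.
  apply: subgroupMr => //; apply: (conjg_mod sE gE) => //.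
  exact: lower_central_comm.
Qed.

Fixpoint power_span E (s : seq G) : set G :=
  if s is a :: s' then [set a ^+ e * r | e in [set: nat] & r in power_span E s'] else E.

Lemma power_spanP E k (s : seq G) : subgroup E -> gamma k.+1 `<=` E ->
    (forall a, a \in s -> gamma k a /\ exists2 m, (0 < m)%N & E (a ^+ m)) ->
  [/\ subgroup (power_span E s), E `<=` power_span E s,
      (forall a, a \in s -> power_span E s a) &
      exists F : seq G, forall w, power_span E s w -> exists2 f, f \in F & E (f^-1 * w)].
Proof.
move=> sE gE; elim: s => [|a s IHs] sP.
  split=> //; exists [:: 1] => w Ew; exists 1; first by rewrite inE.
  by rewrite invg1 mul1g.
have /IHs[sR ER Rs [F FP]] : forall a, a \in s ->
    gamma k a /\ exists2 m, (0 < m)%N & E (a ^+ m).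
  by move=> b bs; apply: sP; rewrite inE bs orbT.
have [ga [m m0 Eam]] := sP a (mem_head _ _).
have gR : gamma k.+1 `<=` power_span E s by move=> g /gE/ER.
set R := power_span E s in sR ER Rs FP gR *.
set R' := power_span E (a :: s).
have RR' : R `<=` R' by move=> r Rr; exists 0%N => //; exists r; rewrite // expg0 mul1g.
have R'a : R' a.
  by exists 1%N => //; exists 1; [apply: subgroup1|rewrite expg1 mulg1].
have R'M u v : R' u -> R' v -> R' (u * v).
  move=> [e _ [r Rr <-]] [e' _ [r' Rr' <-]]; exists (e + e')%N => //.
  exists (r ^ (a ^+ e') * r').
    by apply: subgroupM => //; apply: (conjg_by_mod sR gR) => //; exact: lower_centralX.
  by rewrite /conjg expgnDr !mulgA mulgK.
have R'1 : R' 1 by exact: RR' (subgroup1 sR).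
have R'X u n : R' u -> R' (u ^+ n).
  by move=> R'u; elim: n => [|n IHn]; rewrite ?expg0 // expgS; exact: R'M.
(* Exponents are natural numbers, so the inverse is written [a ^+ m.-1 * (a ^+ m)^-1]. *)
have R'aV : R' a^-1.
  exists m.-1 => //; exists (a ^+ m)^-1; first exact: (subgroupV sR (ER _ Eam)).
  by rewrite -{2}(prednK m0) expgS invgM mulVKg.
split.
- apply/subgroupP; split=> // _ [e _ [r Rr <-]].
  by rewrite invgM -expVgn; apply: R'M; [exact: RR' (subgroupV sR Rr)|exact: R'X].
- by move=> g /ER/RR'.
- by move=> b; rewrite inE => /predU1P[->//|/Rs/RR'].
exists [seq a ^+ j * f | j <- iota 0 m, f <- F] => _ [e _ [r Rr <-]].
(* Divide [e] by [m]: the multiple of [m] is absorbed into [R], and the remainder ranges over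
   [iota 0 m]. *)
have [|f Ff Ef] := FP (a ^+ (m * (e %/ m)) * r).
  by apply: subgroupM => //; rewrite expgnA; apply: (subgroupX _ sR); exact: ER.
exists (a ^+ (e %% m) * f).
  by apply/allpairsP; exists ((e %% m)%N, f); rewrite mem_iota ltn_mod m0.
rewrite {2}(divn_eq e m) addnC expgnDr invgM !mulgA mulgVK.
by rewrite (mulnC (e %/ m)) -mulgA.
Qed.

(* The commutators [~ a, x] of generators [a] of [gamma k] modulo [gamma k.+1] and
   [x \in X] generate [gamma k.+1] modulo [gamma k.+2], and bilinearity of the
   commutator modulo [gamma k.+2] turns powers of [a] and [x] into powers of [~ a, x]. *)
Lemma lower_central_power_gen H (X : seq G) k : subgroup H ->
    smallest (@subgroup G) [set` X] = [set: G] ->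
    (forall x, x \in X -> exists2 n, (0 < n)%N & H (x ^+ n)) ->
  exists s : seq G,
    (forall a, a \in s -> gamma k a /\
       exists2 m, (0 < m)%N & mul_lower H k.+1 (a ^+ m)) /\
    gamma k `<=` smallest (@subgroup G) ([set` s] `|` gamma k.+1).
Proof.
move=> sH genX HX; elim: k => [|k [s [sP gens]]].
  exists X; split=> [x /HX[n n0 Hn]|].
    by split=> //; exists n => //; exact: sub_mul_lowerl.
  by rewrite /= -{1}genX; apply: sub_smallest2r; [exact: smallest_subgroup|left].
exists [seq [~ a, x] | a <- s, x <- X]; split; last first.
  by apply: lower_central_gen => // a /sP[].
move=> _ /allpairsP[[a x] /= [/sP[ga [m m0 [h Hh [u gu e]]]] /HX[n n0 Hx] ->]].
split; first exact: lower_central_comm.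
exists (m * n)%N; first by rewrite muln_gt0 m0.
have sE : subgroup (mul_lower H k.+2) by exact: mul_lower_subgroup.
have gE := @sub_mul_lowerr H k.+2 sH.
have gam : gamma k (a ^+ m) by exact: lower_centralX.
have gh : gamma k h.
  apply: subgroupMr (lower_central_subgroup G k) (lower_centralS gu) _.
  by rewrite e.
have [t gt et] := commgX_mod x n gam.
have [t' gt' et'] := commXg_mod x m ga.
(* With [a ^+ m = h * u], the commutator is [[~ h, x ^+ n] ^ u * [~ u, x ^+ n]]: the first factor is
   a conjugate of an element of [H], the second lies in [gamma k.+2]. *)
have : mul_lower H k.+2 [~ a ^+ m, x ^+ n].
  rewrite -e commgMl; apply: subgroupM => //; last first.
    by apply: gE; exact: lower_central_comm.
  apply: (conjg_mod sE gE); first exact: lower_central_comm.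
  apply: sub_mul_lowerl; apply: subgroupM => //; first exact: subgroupV.
  apply: subgroupM => //; first exact: subgroupV.
  by apply: subgroupM.
rewrite et => /(subgroupMr sE (gE _ gt)); rewrite et'.
have [t'' gt'' ->] := expgM_mod ([~ a, x] ^+ m) n gt'.
by move=> /(subgroupMr sE (gE _ gt'')); rewrite expgnA.
Qed.

(** Climbing the series from its trivial term, each term is covered by finitely many left cosets of
    [H]: it meets finitely many cosets of [H] times the next term, and that term is already
    covered. *)
Lemma nilpotent_finite_index H (X : seq G) : nilpotent G -> subgroup H ->
    smallest (@subgroup G) [set` X] = [set: G] ->
    (forall x, x \in X -> exists2 n, (0 < n)%N & H (x ^+ n)) ->
  fi_subgroup H.
Proof.
move=> [c gc1] sH genX HX.
suff main k : (k <= c)%N -> exists F : seq G, forall w, gamma (c - k) w ->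
    exists2 f, f \in F & H (f^-1 * w).
  have [F FP] := main c (leqnn c); apply: (finite_cosets_index (F := F)) => // g.
  by apply: FP; rewrite subnn.
elim: k => [_|k IHk ltkc].
  exists [:: 1] => w; rewrite subn0 gc1 => ->; exists 1; first by rewrite inE.
  by rewrite mulg1 invg1; exact: subgroup1.
have [F FP] := IHk (ltnW ltkc).
have [s [sP gens]] := lower_central_power_gen (c - k.+1) sH genX HX.
rewrite subnSK // in sP gens.
have sE : subgroup (mul_lower H (c - k)) by exact: mul_lower_subgroup.
have gE := @sub_mul_lowerr H (c - k) sH.
have [||sR ER Rs [F' F'P]] := @power_spanP (mul_lower H (c - k)) (c - k.+1) s sE.
- by rewrite subnSK.
- exact: sP.
exists [seq f' * f | f' <- F', f <- F] => w /gens gw.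
have : power_span (mul_lower H (c - k)) s w.
  by apply: smallest_sub gw => // v [/Rs//|/gE/ER].
(* Here [w = f' * h * u]; moving [u] to the left of [h] turns it into [u ^ h^-1], still in the
   covered term. *)
move=> /F'P[f' Ff' [h Hh [u gu e]]].
have [f Ff Hf] := FP (u ^ h^-1) (lower_central_conj _ gu).
exists (f' * f); first by apply/allpairsP; exists (f', f).
have -> : (f' * f)^-1 * w = f^-1 * (u ^ h^-1) * h.
  rewrite invgM -mulgA -e /conjg invgK !mulgA mulgVK //.
exact: subgroupM.
Qed.

End PowersFiniteIndex.
(* MathComp proves these only for morphisms of unital magmas, a structure which is not
   inferred for a merely multiplicative map between groups. *)
Section GroupMorphism.
Variables (G H : groupType) (f : {multiplicative G -> H}).

Lemma morph1 : f 1 = 1.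
Proof. by apply: (@mulgI _ (f 1)); rewrite -gmulfM !mulg1. Qed.

Lemma morphV : {morph f : x / x^-1}.
Proof. by move=> x; apply/divg1_eq; rewrite invgK -gmulfM mulVg morph1. Qed.

Lemma morphXn n : {morph f : x / x ^+ n}.
Proof. by move=> x; elim: n => [|n IHn]; rewrite ?expg0 ?morph1 // !expgS gmulfM IHn. Qed.

Lemma morphR : {morph f : x y / [~ x, y]}.
Proof. by move=> x y; rewrite !gmulfM !morphV. Qed.

End GroupMorphism.

(** * Nilpotency of subgroups and products, and isolators *)

Lemma lower_central_morph (G H : groupType) (f : {multiplicative G -> H}) k g :
  @lower_central G k g -> @lower_central H k (f g).
Proof.
elim: k g => [//|k IHk]; apply: smallest_sub => [|_ [u gu [v _ <-]]].
  apply/subgroupP; split.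
  - by rewrite morph1; exact: lower_central1.
  - by move=> x y fx fy; rewrite gmulfM; exact: lower_centralM.
  - by move=> x fx; rewrite morphV; exact: lower_centralV.
by rewrite /= morphR; apply: lower_central_comm; exact: IHk.
Qed.

Lemma nilpotent_inj (G H : groupType) (f : {multiplicative G -> H}) :
  injective f -> nilpotent H -> nilpotent G.
Proof.
move=> f_inj [c gc1]; exists c; apply/seteqP; split=> [g /(lower_central_morph f)|_ ->].
  by rewrite gc1 => e; apply: f_inj; rewrite morph1.
exact: lower_central1.
Qed.

Lemma nilpotent_prod (G H : groupType) :
  nilpotent G -> nilpotent H -> nilpotent (G * H)%type.
Proof.
move=> [c gc1] [d gd1].
have le_lower (K : groupType) m n :
    (m <= n)%N -> @lower_central K n `<=` @lower_central K m.
  move=> /subnK <-; elim: (n - m)%N => [|j IHj] //.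
  by apply: subset_trans IHj; exact: lower_centralS.
exists (maxn c d); apply/seteqP; split=> [g gg|_ ->]; last exact: lower_central1.
have := le_lower _ _ _ (leq_maxl c d) _ (lower_central_morph fst gg).
have := le_lower _ _ _ (leq_maxr c d) _ (lower_central_morph snd gg).
by rewrite gc1 gd1; case: g {gg} => x y /= -> ->.
Qed.

Section SubgroupType.
Variables (G : groupType) (A : set G).

(** The proof that [A] is a subgroup is an argument of the type, so that the group structure can be
    attached to it. *)
Definition subgroup_type of subgroup A := {x : G | [in A] x}.

Variable sA : subgroup A.

HB.instance Definition _ := SubChoice.on (subgroup_type sA).
HB.instance Definition _ :=
  SubChoice_isSubGroup.Build G [in A] (subgroup_type sA) sA.

End SubgroupType.

(** Inside the subgroup generated by [x] and [y], the trace of [H] has finite index, so it contains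
    a power of [x * y]. *)
Lemma isolatorM (G : groupType) (H : set G) x y :
    nilpotent G -> subgroup H ->
    (exists2 n, (0 < n)%N & H (x ^+ n)) -> (exists2 n, (0 < n)%N & H (y ^+ n)) ->
  exists2 n, (0 < n)%N & H ((x * y) ^+ n).
Proof.
move=> nilG sH Hx Hy.
pose A := smallest (@subgroup G) [set` [:: x; y]].
have sA : subgroup A := smallest_subgroup _.
have Ax : A x by apply: sub_gen_smallest; rewrite /= inE eqxx.
have Ay : A y by apply: sub_gen_smallest; rewrite /= !inE eqxx orbT.
pose S : groupType := subgroup_type sA.
pose f : {multiplicative S -> G} := val.
pose x' : S := Sub x (mem_set Ax); pose y' : S := Sub y (mem_set Ay).
have fx : f x' = x by exact: SubK.
have fy : f y' = y by exact: SubK.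
have f_inj : injective f by exact: val_inj.
have sH' : subgroup (f @^-1` H).
  apply/subgroupP; split=> [|u v|u]; rewrite /= ?morph1 ?gmulfM ?morphV.
  - exact: subgroup1.
  - exact: subgroupM.
  - exact: subgroupV.
have [|z|n n0] := finite_index_power (x' * y')
    (@nilpotent_finite_index S (f @^-1` H) [:: x'; y'] (nilpotent_inj f_inj nilG) sH' _ _).
- apply/seteqP; split=> // a _.
  have : A (f a) by apply: set_mem; exact: valP.
  set B := smallest _ [set` [:: x'; y']].
  have sB : subgroup B by exact: smallest_subgroup.
  have Bx : B x' by apply: sub_gen_smallest; rewrite /= inE eqxx.
  have By : B y' by apply: sub_gen_smallest; rewrite /= !inE eqxx orbT.
  (* To see that [x'] and [y'] generate [S], push [B] into [G]: its image is a subgroup containing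
     [x] and [y], hence [A]. *)
  clearbody B; suff AB : A `<=` f @` B by move=> /AB[b Bb /f_inj <-].
  apply: smallest_sub.
    apply/subgroupP; split.
    - by exists 1; rewrite ?morph1 //; exact: subgroup1.
    - move=> _ _ [u Bu <-] [v Bv <-]; exists (u * v); first exact: subgroupM.
      by rewrite gmulfM.
    - by move=> _ [u Bu <-]; exists u^-1; [exact: subgroupV|rewrite morphV].
  by move=> z; rewrite /= !inE => /orP[] /eqP ->; [exists x'|exists y'].
- rewrite !inE => /orP[] /eqP ->.
    by case: Hx => n n0 Hn; exists n; rewrite // /preimage /mkset morphXn fx.
  by case: Hy => n n0 Hn; exists n; rewrite // /preimage /mkset morphXn fy.
by rewrite /preimage /mkset morphXn gmulfM fx fy => Hn; exists n.
Qed.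

Lemma cmapX (G : groupType) (a : commensuration G) x n :
  cdom a x -> cmap a (x ^+ n) = cmap a x ^+ n.
Proof.
have [sH _] := cdom_fi a; move=> Hx.
elim: n => [|n IHn]; first by rewrite !expg0 cmap1.
by rewrite !expgS cmapM ?IHn //; exact: subgroupX.
Qed.

(** * Commensurations of [N] and automorphisms of its completion *)

Section MalcevCompletion.
Variables (N Q : groupType) (i : {multiplicative N -> Q}).
Hypotheses (N_fg : finitely_generated N) (Q_malcev : malcev_completion i).
Implicit Types (a b : commensuration N) (f g : aut Q) (h n : N) (q r : Q).

Let i_inj : injective i. Proof. by case: Q_malcev. Qed.
Let tfQ : torsion_free Q. Proof. by case: Q_malcev. Qed.
Let divQ : divisible Q. Proof. by case: Q_malcev. Qed.
Let nilQ : nilpotent Q. Proof. by case: Q_malcev. Qed.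

Lemma power_in_image (K : set N) q : fi_subgroup K ->
  exists2 m, (0 < m)%N & exists2 h, K h & q ^+ m = i h.
Proof.
move=> fiK; have [_ _ _ _ /(_ q)[m m0 [x _ ex]]] := Q_malcev.
have [l l0 Kxl] := finite_index_power x fiK.
exists (m * l)%N; first by rewrite muln_gt0 m0.
by exists (x ^+ l); rewrite // expgnA -ex morphXn.
Qed.

Definition restr_dom f : set N := [set x | range i (f (i x))].

Lemma restr_dom_fi f : fi_subgroup (restr_dom f).
Proof.
have [A /finite_seqP[X ->] genX] := N_fg.
apply: nilpotent_finite_index genX _.
- exact: nilpotent_inj i_inj nilQ.
- apply/subgroupP; split; rewrite /restr_dom /mkset.
  + by exists 1; rewrite // !morph1.
  + by move=> x y [u _ eu] [v _ ev]; exists (u * v); rewrite // !gmulfM eu ev.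
  + by move=> x [u _ eu]; exists u^-1; rewrite // !morphV eu.
move=> x _; have [m m0 [h _ e]] := power_in_image (f (i x)) (fi_subgroupT N).
by exists m => //; exists h; rewrite // !morphXn e.
Qed.

(** The default [1] is taken only outside [restr_dom f], where the values of a commensuration are
    irrelevant. *)
Definition restr_map f (x : N) : N := xget 1 [set y | i y = f (i x)].

Lemma restr_mapE f x : restr_dom f x -> i (restr_map f x) = f (i x).
Proof. by move=> [y _ ey]; rewrite /restr_map; case: xgetP => [//|/(_ y)]. Qed.

Lemma restr_mapM f x y : restr_dom f x -> restr_dom f y ->
  restr_map f (x * y) = restr_map f x * restr_map f y.
Proof.
move=> fx fy; apply: i_inj; rewrite gmulfM !restr_mapE ?gmulfM //.
by have [sf _] := restr_dom_fi f; exact: subgroupM.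
Qed.

Lemma restr_map_bij f :
  set_bij (restr_dom f) (restr_dom (aut_inv f)) (restr_map f).
Proof.
have fK : cancel f (aut_inv f) by exact: aut_inv_funK.
have fVK : cancel (aut_inv f) f by exact: aut_inv_funKV.
split.
- move=> x fx; rewrite /restr_dom /mkset restr_mapE // fK; by exists x.
- move=> x y /set_mem fx /set_mem fy /(congr1 i); rewrite !restr_mapE // => e.
  exact/i_inj/(can_inj fK).
- move=> y [x _ ex]; have fx : restr_dom f x by exists y; rewrite // ex fVK.
  by exists x => //; apply: i_inj; rewrite restr_mapE // ex fVK.
Qed.

Definition restr f : commensuration N :=
  Commensuration (restr_dom_fi f) (restr_dom_fi (aut_inv f)) (@restr_mapM f)
    (restr_map_bij f).

(** The correspondence behind the isomorphism: [f] determines [a] up to [comm_equiv], and the class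
    of [a] determines [f]. *)
Definition extends f a : Prop := forall h, cdom a h -> i (cmap a h) = f (i h).

Lemma extends_restr f : extends f (restr f).
Proof. by move=> h /restr_mapE. Qed.

Lemma extends_comp f g a b :
  extends f a -> extends g b -> extends (f * g) (comm_comp a b).
Proof. by move=> fa gb h [bh abh]; rewrite /= /ccomp_map /= fa // gb. Qed.

Lemma extends_equiv f a b : extends f a -> extends f b -> comm_equiv a b.
Proof.
move=> fa fb; exists (cdom a `&` cdom b); split=> //.
  exact: fi_subgroupI (cdom_fi a) (cdom_fi b).
by move=> x /set_mem[ax bx]; apply: i_inj; rewrite fa // fb.
Qed.

(** Both automorphisms agree on a power of [q] lying in [K], and roots in [Q] are unique. *)
Lemma extends_inj f g a b :
  extends f a -> extends g b -> comm_equiv a b -> f = g.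
Proof.
move=> fa gb [K [fiK sK eab]]; apply: aut_eqP => q.
have [m m0 [h Kh e]] := power_in_image q fiK.
apply: (unique_root tfQ nilQ m0); rewrite -!morphXn e.
by have [ah bh] := sK _ Kh; rewrite -fa // -gb // eab ?inE.
Qed.

(** * Extending a commensuration to the completion *)

Section Extension.
Variable a : commensuration N.

Definition root_graph q r : Prop := exists2 m, (0 < m)%N &
  exists2 h, cdom a h & q ^+ m = i h /\ r ^+ m = i (cmap a h).

Lemma root_graph_total q : exists r, root_graph q r.
Proof.
have [m m0 [h ah e]] := power_in_image q (cdom_fi a).
have [r er] := divQ (i (cmap a h)) m0.
by exists r; exists m => //; exists h.
Qed.

(** Both [r] and [r'] are roots of order [m * m'] of the image under [a] of [q ^+ (m * m')]. *)
Lemma root_graph_fun q r r' : root_graph q r -> root_graph q r' -> r = r'.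
Proof.
move=> [m m0 [h ah [eq er]]] [m' m'0 [h' ah' [eq' er']]].
apply: (@unique_root _ (m * m')%N); rewrite ?muln_gt0 ?m0 //.
rewrite expgnA er mulnC expgnA er' -!morphXn -!cmapX //.
congr (i (cmap a _)); apply: i_inj; rewrite !morphXn -eq -eq'.
by rewrite -!expgnA mulnC.
Qed.

(* The graph is the isolator of a subgroup of [Q * Q], the graph of [cmap a]. *)
Lemma root_graphM q r q' r' :
  root_graph q r -> root_graph q' r' -> root_graph (q * q') (r * r').
Proof.
have [sa _] := cdom_fi a.
pose G : set (Q * Q)%type := [set p | exists2 h, cdom a h & p = (i h, i (cmap a h))].
have sG : subgroup G.
  apply/subgroupP; split.
  - by exists 1; [exact: subgroup1|rewrite cmap1 !morph1].
  - move=> _ _ [h ah ->] [h' ah' ->]; exists (h * h'); first exact: subgroupM.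
    by rewrite cmapM // !gmulfM.
  - move=> _ [h ah ->]; exists h^-1; first exact: subgroupV.
    by rewrite cmapV // !morphV.
have XE (x y : Q) m : (x, y) ^+ m = (x ^+ m, y ^+ m) :> (Q * Q)%type.
  by elim: m => [//|m IHm]; rewrite !expgS IHm.
have GP x y : root_graph x y <-> exists2 m, (0 < m)%N & G ((x, y) ^+ m).
  split=> [] [m m0].
    by move=> [h ah [ex ey]]; exists m => //; exists h; rewrite // XE ex ey.
  by move=> [h ah]; rewrite XE => -[ex ey]; exists m => //; exists h.
move=> /GP qr /GP qr'; apply/GP.
exact: (isolatorM (nilpotent_prod nilQ nilQ) sG qr qr').
Qed.

End Extension.

Lemma root_graph_inv a q r : root_graph a q r -> root_graph (comm_inv a) r q.
Proof.
move=> [m m0 [h ah [eq er]]]; exists m => //; exists (cmap a h).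
  exact: cmap_cod.
by rewrite /= cinv_mapK.
Qed.

Lemma commensuration_extends a : exists f, extends f a.
Proof.
have [F FP] := choice (root_graph_total a).
have [F' F'P] := choice (root_graph_total (comm_inv a)).
have FM : {morph F : q r / q * r}.
  by move=> q r; apply: root_graph_fun (FP _) _; exact: root_graphM.
have FK : cancel F F'.
  move=> q; apply: root_graph_fun (F'P _) _; exact: root_graph_inv.
have F'K : cancel F' F.
  move=> q; apply: root_graph_fun (FP _) _.
  have [m m0 [h ah [eq er]]] := F'P q; have [inv_h ih] := cinv_mapP ah.
  by exists m => //; exists (cinv_map a h); rewrite ?ih.
pose mM := isMultiplicative.Build Q Q F FM.
pose FF : {multiplicative Q -> Q} := HB.pack F mM.
exists (@MkAut Q FF (Bijective FK F'K)) => h ah.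
(* Exponent [1] shows that [i h] is related to [i (cmap a h)]. *)
apply: root_graph_fun (FP _); exists 1%N => //; exists h => //.
Qed.

End MalcevCompletion.

Theorem theorem9 (N NQ : groupType) (i : {multiplicative N -> NQ})
    (N_fg : finitely_generated N) (N_tf : torsion_free N) (N_nil : nilpotent N)
    (NQ_malcev : malcev_completion i) :
  group_isomorphic (Comm N) (aut NQ).
Proof.
pose Psi f : Comm N := \pi_(Comm N) (restr N_fg NQ_malcev f).
have PsiE f a : extends i f a -> Psi f = \pi_(Comm N) a.
  move=> fa; apply/CommP; apply: (extends_equiv NQ_malcev) fa.
  exact: extends_restr.
have /choice[Phi PhiP] (u : Comm N) : exists f, extends i f (repr u).
  exact: commensuration_extends.
have PhiK : cancel Phi Psi by move=> u; rewrite (PsiE _ _ (PhiP u)) reprK.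
have PsiK : cancel Psi Phi.
  move=> f; have e : comm_equiv (repr (Psi f)) (restr N_fg NQ_malcev f).
    exact: comm_reprP.
  exact: (extends_inj NQ_malcev (PhiP (Psi f)) (@extends_restr _ _ _ N_fg NQ_malcev f) e).
have PhiM : {morph Phi : u v / u * v}.
  (* After applying the injective [Psi], both sides are the class of the composite of the
     representatives of [u] and [v]. *)
  move=> u v; apply: (can_inj PsiK); rewrite PhiK.
  by rewrite (PsiE _ _ (extends_comp (PhiP u) (PhiP v))).
pose mM := isMultiplicative.Build (Comm N) (aut NQ) Phi PhiM.
by exists (HB.pack Phi mM : {multiplicative Comm N -> aut NQ}); exists Psi.
Qed.
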